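(* Let $A\in\mathbb{M}_d$. Then there exists a contraction $K\in\mathbb{M}_d$ such that $$A=|A|_{\vee}^{1/2}\,K\,|A|_{\vee}^{1/2}.$$
   Context: $d\ge 1$ is an integer and $\mathbb{M}_d$ is the space of complex $d\times d$ matrices. For $A\in\mathbb{M}_d$, $|A|=(A^*A)^{1/2}$, so $|A^*|=(AA^* )^{1/2}$. The maximal modulus of $A$ is the positive semidefinite matrix defined by Kato's formula $$|A|_{\vee}:=\lim_{n\to\infty}\left(|A|^n+|A^*|^n\right)^{1/n}$$ (the limit exists; it is the supremum of $|A|$ and $|A^*|$ in Olson's spectral order). Powers of positive semidefinite matrices are taken by functional calculus. A contraction is a matrix $K$ with operator norm $\|K\|_\infty\le 1$. *)

(* Defs.v *)
From HB Require Import structures.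
From mathcomp Require Import all_boot all_order all_algebra.
From mathcomp Require Import complex.
From mathcomp Require Import all_classical all_reals all_analysis.

Set Implicit Arguments.
Unset Strict Implicit.
Unset Printing Implicit Defensive.

Import Order.TTheory GRing.Theory Num.Theory.
Import numFieldTopology.Exports.
Import ComplexField.

Local Open Scope classical_set_scope.
Local Open Scope ring_scope.
Local Open Scope sesquilinear_scope.
Local Open Scope complex_scope.

(* Functional calculus f(A) on normal matrices: by [orthomx_spectralP], a
   normal A is the conjugate of [diag_mx (spectral_diag A)] by the unitary
   matrix [spectralmx A].  The value is only meaningful for normal A; below,
   A is always positive semidefinite. *)
Definition mxfun (C : numClosedFieldType) (d : nat) (f : C -> C)
    (A : 'M[C]_d) : 'M[C]_d :=
  invmx (spectralmx A) *m diag_mx (map_mx f (spectral_diag A))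
    *m spectralmx A.

(* A^{1/n} for A positive semidefinite: on nonnegative numbers [n.-root] is the
   nonnegative n-th root.  The n = 0 value is junk. *)
Definition mxroot (C : numClosedFieldType) (d n : nat) (A : 'M[C]_d) :
    'M[C]_d :=
  mxfun (fun x => n.-root x) A.

Definition absmx (C : numClosedFieldType) (d : nat) (A : 'M[C]_d) : 'M[C]_d :=
  mxroot 2 (A ^t* *m A).

Definition kato_seq (C : numClosedFieldType) (d : nat) (A : 'M[C]_d) (n : nat) :
    'M[C]_d :=
  mxroot n (absmx A ^+ n + absmx (A ^t*) ^+ n).

(* The limit is for the entrywise topology of 'M[C]_d. *)
Definition maxmod (C : numClosedFieldType) (d : nat) (A : 'M[C]_d) : 'M[C]_d :=
  lim (kato_seq A @ \oo).

Definition l2norm (R : realType) (d : nat) (v : 'cV[R[i]]_d) : R :=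
  Num.sqrt (\sum_(j < d) Normc.normc (v j 0) ^+ 2).

Definition opnorm (R : realType) (d : nat) (K : 'M[R[i]]_d) : R :=
  sup [set l2norm (K *m v) | v in [set v : 'cV[R[i]]_d | l2norm v <= 1]].

Definition contraction_mx (R : realType) (d : nat) (K : 'M[R[i]]_d) : Prop :=
  opnorm K <= 1.

(* Main.v *)
(* Put P = |A| and Q = |A^*|.  Running Gram-Schmidt through the eigenvectors of
   P and Q in order of decreasing eigenvalue gives an orthonormal basis (w_j)
   with weights m_j; let M be the matrix with eigenpairs (m_j, w_j).  By
   construction the spectral subspaces of P and Q for [l, oo[ are contained in
   the one of M, so that P^n <= M^n and Q^n <= M^n for all n, and they span it,
   so that M^n <= c (P^n + Q^n) with c independent of n.  Comparing the
   eigenpairs (b, u) of (P^n + Q^n)^{1/n} with those of M, the two bounds give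
   b^n |<u, w>|^2 <= 2 m^n and m^n |<u, w>|^2 <= c b^n, which force
   (b - m)^2 |<u, w>|^2 = O(1/n): Kato's sequence tends to M in Frobenius norm.
   In particular P <= M and Q <= M.  As 2 Re <Ay, x> <= <Py, y> + <Qx, x>,
   the matrix K = M^{-1/2} A M^{-1/2}, with a pseudo-inverse of M^{1/2}, is a
   contraction. *)
Require Import Defs.
From mathcomp Require Import all_boot all_order all_algebra.
From mathcomp Require Import complex.
From mathcomp Require Import all_classical all_reals all_analysis.
From mathcomp Require Import ring lra.

Set Implicit Arguments.
Unset Strict Implicit.
Unset Printing Implicit Defensive.

Import Order.TTheory GRing.Theory Num.Theory.
Import numFieldTopology.Exports numFieldNormedType.Exports.

Local Open Scope ring_scope.
Local Open Scope sesquilinear_scope.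
Local Open Scope complex_scope.

(** * Limits of matrices, entry by entry *)

Lemma lim_mx_entrywise (C : numFieldType) (d : nat) (B : nat -> 'M[C]_d)
    (M : 'M[C]_d) :
  (forall e : C, 0 < e ->
    exists N, forall n i j, (N <= n)%N -> `|B n i j - M i j| < e) ->
  lim (B @ \oo)%classic = M.
Proof.
move=> BM; apply: cvg_lim => //; apply/cvg_ballP => e e0.
have [N BMN] := BM e e0; exists N => // n /= Nn.
by split=> // i j; rewrite -ball_normE /= distrC; exact: BMN.
Qed.

(** * Squared moduli and roots of complex numbers *)

Section SquaredModulus.
Variable R : rcfType.
Implicit Types z w : R[i].

Definition sqn z : R := complex.Re z ^+ 2 + complex.Im z ^+ 2.

Lemma sqnE z : (sqn z)%:C = z * Num.conj z.
Proof. by rewrite /sqn add_Re2_Im2 normCK. Qed.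

Lemma sqn_ge0 z : 0 <= sqn z.
Proof. by rewrite addr_ge0 ?sqr_ge0. Qed.

Lemma sqn_eq0 z : (sqn z == 0) = (z == 0).
Proof.
by rewrite -(inj_eq (@complexI R)) sqnE mulf_eq0 conjC_eq0 orbb.
Qed.

Lemma sqn0 : sqn 0 = 0.
Proof. by apply/eqP; rewrite sqn_eq0. Qed.

Lemma sqnM z w : sqn (z * w) = sqn z * sqn w.
Proof. by case: z => a b; case: w => c d; rewrite /sqn /=; ring. Qed.

Lemma sqn_real (a : R) : sqn a%:C = a ^+ 2.
Proof. by rewrite /sqn /= expr0n /= addr0. Qed.

Lemma sqn_conj z : sqn (Num.conj z) = sqn z.
Proof. by apply: complexI; rewrite !sqnE conjCK mulrC. Qed.

Lemma sqnD z w : sqn (z + w) <= 2 * sqn z + 2 * sqn w.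
Proof.
case: z => a b; case: w => c d; rewrite /sqn /=.
have := sqr_ge0 (a - c); have := sqr_ge0 (b - d); nra.
Qed.

Lemma conjC_real (a : R) : Num.conj a%:C = a%:C :> R[i].
Proof. exact: conjc_real. Qed.

Lemma ReD z w : complex.Re (z + w) = complex.Re z + complex.Re w.
Proof. by case: z; case: w. Qed.

Lemma ReN z : complex.Re (- z) = - complex.Re z.
Proof. by case: z. Qed.

Lemma rootC_real n (s : R) : 0 <= s -> n.-root (s%:C : R[i]) =
  (complex.Re (n.-root (s%:C : R[i])))%:C.
Proof.
case: n => [|n] s0; first by rewrite root0C.
by rewrite RRe_real // ger0_real // rootC_ge0 // ler0c.
Qed.

Lemma rootC_sqr (s : R) : 0 <= s -> 2.-root ((s ^+ 2)%:C : R[i]) = s%:C.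
Proof.
by move=> s0; rewrite rmorphXn /= exprCK // ler0c.
Qed.

End SquaredModulus.

(** * Matrices given by a spectral decomposition and their quadratic forms *)

Section Forms.
Variable R : rcfType.
Notation C := R[i].

Definition nsq n (y : 'rV[C]_n) : R := \sum_j sqn (y 0 j).

(** Forms are taken on row vectors, so the eigenvectors are the rows of [W]. Their number [r] is
    kept apart from [d] because Gram-Schmidt builds [W] one row at a time. *)
Definition specmx r d (W : 'M[C]_(r, d)) (g : 'I_r -> C) : 'M[C]_d :=
  W ^t* *m diag_mx (\row_i g i) *m W.

Definition wform r d (W : 'M[C]_(r, d)) (a : 'I_r -> R) (x : 'rV[C]_d) : R :=
  \sum_i a i * sqn ((x *m W ^t*) 0 i).

Lemma trmxCM m n p (A : 'M[C]_(m, n)) (B : 'M[C]_(n, p)) :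
  (A *m B) ^t* = B ^t* *m A ^t*.
Proof. by rewrite trmx_mul map_mxM. Qed.

Lemma trmxCB m n (A B : 'M[C]_(m, n)) : (A - B) ^t* = A ^t* - B ^t*.
Proof. by apply/matrixP => i j; rewrite !mxE rmorphB. Qed.

Lemma trmxC1 n : (1%:M : 'M[C]_n) ^t* = 1%:M.
Proof. by rewrite trmx1 map_mx1. Qed.

Lemma nsq_ge0 n (y : 'rV[C]_n) : 0 <= nsq y.
Proof. by apply: sumr_ge0 => j _; exact: sqn_ge0. Qed.

Lemma nsqE n (y : 'rV[C]_n) : y *m y ^t* = ((nsq y)%:C)%:M.
Proof.
apply/matrixP => i j; rewrite !ord1 !mxE eqxx mulr1n /nsq rmorph_sum /=.
by apply: eq_bigr => k _; rewrite !mxE sqnE.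
Qed.

Lemma nsq_row n r (X : 'M[C]_(r, n)) i :
  (nsq (row i X))%:C = (X *m X ^t*) i i.
Proof.
rewrite mxE /nsq rmorph_sum; apply: eq_bigr => k _.
by rewrite /= sqnE !mxE.
Qed.

Lemma nsq_inj n n' (y : 'rV[C]_n) (z : 'rV[C]_n') :
  y *m y ^t* = z *m z ^t* -> nsq y = nsq z.
Proof.
by rewrite !nsqE => /matrixP/(_ 0 0); rewrite !mxE eqxx !mulr1n => -[].
Qed.

Lemma nsq_eq0 n (y : 'rV[C]_n) : nsq y = 0 -> y = 0.
Proof.
move=> /eqP; rewrite psumr_eq0 => [/allP y0|j _]; last exact: sqn_ge0.
apply/rowP => j; apply/eqP; rewrite mxE -sqn_eq0.
by have := y0 j; rewrite mem_index_enum => /(_ isT).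
Qed.

Lemma nsq_isom n r (T : 'M[C]_(r, n)) (y : 'rV[C]_n) :
  (T ^t*) *m T = 1%:M -> nsq (y *m T ^t*) = nsq y.
Proof.
move=> T1; apply: nsq_inj.
by rewrite trmxCM trmxCK mulmxA -(mulmxA y) T1 mulmx1.
Qed.

Lemma specmx_trC r d (W : 'M[C]_(r, d)) (g : 'I_r -> C) :
  (specmx W g) ^t* = specmx W (fun i => Num.conj (g i)).
Proof.
rewrite /specmx trmxCM trmxCM trmxCK mulmxA.
suff -> : (diag_mx (\row_i g i)) ^t* = diag_mx (\row_i Num.conj (g i)) by [].
by apply/matrixP => i j; rewrite !mxE eq_sym; case: eqP => [->|_];
  rewrite ?mulr1n ?mulr0n ?rmorph0.
Qed.

Lemma specmx_row r d (W : 'M[C]_(r, d)) (D : 'rV[C]_r) :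
  W ^t* *m diag_mx D *m W = specmx W (D 0).
Proof.
rewrite /specmx; suff {1}-> : D = \row_i D 0 i by [].
by apply/rowP => i; rewrite mxE.
Qed.

Lemma specmxM r d (W : 'M[C]_(r, d)) (g h : 'I_r -> C) : W *m W ^t* = 1%:M ->
  specmx W g *m specmx W h = specmx W (fun i => g i * h i).
Proof.
move=> W1; rewrite /specmx -!mulmxA (mulmxA W) W1 mul1mx.
rewrite (mulmxA (diag_mx _)) mulmx_diag.
suff -> : \row_i ((\row_i g i) 0 i * (\row_i h i) 0 i) =
  \row_i (g i * h i) by [].
by apply/rowP => i; rewrite !mxE.
Qed.

Lemma eq_specmx r d (W : 'M[C]_(r, d)) (g h : 'I_r -> C) : g =1 h ->
  specmx W g = specmx W h.
Proof.
move=> gh; rewrite /specmx; suff -> : \row_i g i = \row_i h i by [].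
by apply/rowP => i; rewrite !mxE gh.
Qed.

Lemma specmx1 r d (W : 'M[C]_(r, d)) : (W ^t*) *m W = 1%:M ->
  specmx W (fun=> 1) = 1%:M.
Proof.
move=> W1; rewrite /specmx.
have -> : diag_mx (\row_i (1 : C)) = 1%:M :> 'M[C]_r.
  by apply/matrixP => i j; rewrite !mxE.
by rewrite mulmx1.
Qed.

Lemma specmxX r d (W : 'M[C]_(r, d)) (g : 'I_r -> C) n : W *m W ^t* = 1%:M ->
  (W ^t*) *m W = 1%:M -> specmx W g ^+ n = specmx W (fun i => g i ^+ n).
Proof.
move=> W1 W2; elim: n => [|n IHn]; first by rewrite expr0 specmx1.
rewrite exprS IHn [LHS](specmxM _ _ W1).
by apply: eq_specmx => i; rewrite exprS.
Qed.

Lemma specmx_form r d (W : 'M[C]_(r, d)) (a : 'I_r -> R) (x : 'rV[C]_d) :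
  x *m specmx W (fun i => (a i)%:C) *m x ^t* = ((wform W a x)%:C)%:M.
Proof.
rewrite /wform; have -> : x *m specmx W (fun i => (a i)%:C) *m x ^t* =
    (x *m W ^t*) *m diag_mx (\row_i (a i)%:C) *m (x *m W ^t*) ^t*.
  by rewrite trmxCM trmxCK /specmx !mulmxA.
move: (x *m W ^t*) => y.
apply/matrixP => i j; rewrite !ord1 [RHS]mxE eqxx mulr1n mxE rmorph_sum /=.
apply: eq_bigr => k _; rewrite mul_mx_diag rmorphM /= sqnE !mxE.
by rewrite [_ * (a k)%:C]mulrC mulrA.
Qed.

Lemma wform_ge0 r d (W : 'M[C]_(r, d)) (a : 'I_r -> R) (x : 'rV[C]_d) :
  (forall i, 0 <= a i) -> 0 <= wform W a x.
Proof. by move=> a0; apply: sumr_ge0 => i _; rewrite mulr_ge0 ?sqn_ge0. Qed.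

Lemma unitary_trC d (U : 'M[C]_d) : U *m U ^t* = 1%:M -> (U ^t*) *m U = 1%:M.
Proof. exact: mulmx1C. Qed.

(** [mxfun] is computed from one particular diagonalization of [S]. The last clause records that [U]
    is compatible with it, so that roots of [S] can be read off in the basis [U] from real
    eigenvalues. *)
Definition spectral_of d (S U : 'M[C]_d) (s : 'I_d -> R) :=
  [/\ U *m U ^t* = 1%:M, forall i, 0 <= s i, S = specmx U (fun i => (s i)%:C)
    & forall f : C -> C, mxfun f S = specmx U (fun i => f (s i)%:C)].

Lemma psd_spectral_of d (S : 'M[C]_d) : S ^t* = S ->
  (forall x : 'rV_d, 0 <= (x *m S *m x ^t*) 0 0) ->
  exists U s, spectral_of S U s.
Proof.
move=> Sh Spos; set U := spectralmx S.
have Uu : U \is unitarymx := spectral_unitarymx S.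
have U1 : U *m U ^t* = 1%:M by apply/unitarymxP.
have Sn : S \is normalmx.
  by apply/hermitian_normalmx/is_hermitianmxP; rewrite expr0 scale1r Sh.
have SE : S = U ^t* *m diag_mx (spectral_diag S) *m U.
  by rewrite -(invmx_unitary Uu); exact: (orthomx_spectralP Sn).
(* An eigenvalue is the value of the form of [S] at its unit eigenvector, a row of [U]. *)
have Dpos i : 0 <= spectral_diag S 0 i.
  have -> : spectral_diag S 0 i = (row i U *m S *m (row i U) ^t*) 0 0.
    have USU : U *m S *m U ^t* = diag_mx (spectral_diag S).
      by rewrite {1}SE !mulmxA U1 mul1mx -mulmxA U1 mulmx1.
    rewrite rowE trmxCM !mulmxA -(mulmxA _ U) -(mulmxA _ _ (U ^t*)) USU -rowE.
    rewrite mxE (bigD1 i) //= big1 ?addr0 => [|j /negPf ji].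
      by rewrite !mxE !eqxx mulr1n rmorph1 mulr1.
    by rewrite !mxE ji andbF rmorph0 mulr0.
  exact: Spos.
exists U, (fun i => complex.Re (spectral_diag S 0 i)).
have Dr i : (complex.Re (spectral_diag S 0 i))%:C = spectral_diag S 0 i.
  by rewrite RRe_real // ger0_real.
split; first exact: U1.
- by move=> i; rewrite -ler0c Dr.
- by rewrite {1}SE specmx_row; apply: eq_specmx => i; rewrite Dr.
- move=> f; rewrite /mxfun -/U (invmx_unitary Uu) specmx_row.
  by apply: eq_specmx => i; rewrite Dr mxE.
Qed.

End Forms.

(** * Comparison of weighted sums of a monotone function *)

Lemma step_decomposition (R : realDomainType) (f : R -> R) (s : seq R) :
  sorted <%R s -> {in s, forall x, 0 <= f x} ->
  {in s &, {homo f : x y / x <= y}} ->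
  exists L : seq (R * R), {in L, forall p, 0 <= p.1 /\ p.2 \in s} /\
    {in s, forall x, f x = \sum_(p <- L) p.1 * ((p.2 <= x)%R)%:R}.
Proof.
elim: s f => [|x0 s IHs] f ss f0 fh; first by exists [::].
have x0s x : x \in s -> x0 < x.
  by move: ss; rewrite /= lt_path_sortedE => /andP[/allP x0s _] /x0s.
have fx0 : 0 <= f x0 by apply: f0; rewrite mem_head.
have in_s x : x \in s -> x \in x0 :: s by rewrite inE orbC => ->.
(* Once the constant step [f x0] at the smallest point is removed, [f x - f x0] is still nonnegative
   and monotone on the remaining points. *)
have [|x xs|x y xs ys xy|L [L0 Lf]] := IHs (fun x => f x - f x0).
- exact: path_sorted ss.
- by rewrite subr_ge0; apply: fh; rewrite ?mem_head ?in_s // ltW ?x0s.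
- by rewrite lerD2r; apply: fh; rewrite ?in_s.
exists ((f x0, x0) :: L); split=> [p|x].
  rewrite inE => /orP[/eqP->|/L0[p0 ps]]; first by rewrite mem_head.
  by rewrite in_s.
rewrite inE big_cons /= => /orP[/eqP->|xs].
  rewrite lexx mulr1 big_seq big1 ?addr0 // => p /L0[_ /x0s].
  by rewrite ltNge => /negPf->; rewrite mulr0.
by rewrite -Lf // ltW ?x0s // mulr1 subrKC.
Qed.

(* On finitely many points [f] is a nonnegative combination of indicators of
   half-lines, so that comparing the tails suffices. *)
Lemma ler_sum_tails (R : realDomainType) (I J : finType) (f : R -> R)
    (a u : I -> R) (m v : J -> R) :
  (forall i, 0 <= a i) -> (forall j, 0 <= m j) ->
  {in Num.nneg, forall x, 0 <= f x} ->
  {in Num.nneg &, {homo f : x y / x <= y}} ->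
  (forall l, \sum_(i | l <= a i) u i <= \sum_(j | l <= m j) v j) ->
  \sum_i f (a i) * u i <= \sum_j f (m j) * v j.
Proof.
move=> a0 m0 f0 fh tail.
set s := sort <=%R (undup (codom a ++ codom m)).
have as_ i : a i \in s by rewrite mem_sort mem_undup mem_cat codom_f.
have ms j : m j \in s by rewrite mem_sort mem_undup mem_cat codom_f orbT.
have s0 x : x \in s -> x \in Num.nneg.
  rewrite mem_sort mem_undup mem_cat => /orP[] /codomP[i ->];
  by rewrite nnegrE.
have [|x xs|x y xs ys|L [L0 Lf]] := @step_decomposition _ f s.
- by rewrite sort_lt_sorted undup_uniq.
- exact/f0/s0.
- by apply: fh; exact: s0.
(* Exchanging the sums turns both sides into the same nonnegative combination of tail sums. *)
have sumE (K : finType) (b w : K -> R) : (forall k, b k \in s) ->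
    \sum_k f (b k) * w k =
    \sum_(p <- L) p.1 * \sum_(k | p.2 <= b k) w k.
  move=> bs; under eq_bigr do rewrite Lf // mulr_suml.
  rewrite exchange_big; apply: eq_bigr => p _ /=.
  rewrite mulr_sumr [RHS]big_mkcond; apply: eq_bigr => k _.
  by case: ifP => _; rewrite ?mulr1 // mulr0 mul0r.
rewrite !sumE // big_seq [leRHS]big_seq; apply: ler_sum => p /L0[p0 _].
exact: ler_wpM2l.
Qed.

(** * Gram-Schmidt in order of decreasing weight *)

Section GramSchmidt.
Variable R : rcfType.
Notation C := R[i].

(** An inequality between the forms for [n = 1] would not pass to powers. The vanishing of
    [U *m W ^t*] at [k j] when [m j < a k] says more: the spectral subspace of [U] for [[l, oo[]
    lies in that of [W]. This compares the tails at every level [l], hence all powers. *)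
Lemma wform_le r d (U : 'M[C]_d) (W : 'M[C]_(r, d)) (a : 'I_d -> R)
    (m : 'I_r -> R) (n : nat) (x : 'rV[C]_d) :
  U *m U ^t* = 1%:M -> W *m W ^t* = 1%:M -> U *m W ^t* *m W = U ->
  (forall k j, m j < a k -> (U *m W ^t*) k j = 0) ->
  (forall k, 0 <= a k) -> (forall j, 0 <= m j) ->
  wform U (fun k => a k ^+ n) x <= wform W (fun j => m j ^+ n) x.
Proof.
move=> U1 W1 UW Uz a0 m0; apply: (ler_sum_tails (f := fun t => t ^+ n)) => //.
- by move=> t t0; rewrite exprn_ge0.
- by move=> s t s0 t0 st; rewrite lerXn2r.
move=> l; set T := U *m W ^t*; set y := x *m W ^t*.
have T1 : (T ^t*) *m T = 1%:M.
  by rewrite /T trmxCM trmxCK -mulmxA (mulmxA (U ^t*)) (unitary_trC U1) mul1mx.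
have xU : x *m U ^t* = y *m T ^t* by rewrite -{1}UW trmxCM mulmxA.
(* [z] is [y] projected to the weights at least [l]; the rows [k] of [T] with [l <= a k] do not see
   the discarded coordinates. *)
set z : 'rV[C]_r := \row_j (if l <= m j then y 0 j else 0).
have zE : \sum_(j | l <= m j) sqn (y 0 j) = nsq z.
  rewrite /nsq big_mkcond; apply: eq_bigr => j _; rewrite [z _ _]mxE.
  by case: ifP => // _; rewrite sqn0.
rewrite zE -(nsq_isom _ T1) /nsq big_mkcond; apply: ler_sum => k _.
case: ifP => [lak|_]; last exact: sqn_ge0.
rewrite xU; suff -> : (y *m T ^t*) 0 k = (z *m T ^t*) 0 k by [].
rewrite [LHS]mxE [RHS]mxE; apply: eq_bigr => j _; rewrite [z _ _]mxE.
case: ifP => // /negbT; rewrite -ltNge => mjl.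
have Tkj : T k j = 0 by rewrite Uz // (lt_le_trans mjl).
by rewrite ![(T ^t*) _ _]mxE ![(T^T) _ _]mxE Tkj rmorph0 !mulr0.
Qed.

(** For the joint list of eigenpairs of |A| and |A^*| this is the form of |A|^n + |A^*|^n. *)
Definition lform d (L : seq ('rV[C]_d * R)) (n : nat) (x : 'rV[C]_d) : R :=
  \sum_(p <- L) p.2 ^+ n * sqn ((x *m p.1 ^t*) 0 0).

(* For fixed [L] and [l >= 0] the vectors [v] dominated in this sense form a
   subspace, which contains every vector of [L] of weight at least [l]. *)
Definition dominated d (L : seq ('rV[C]_d * R)) (l : R) (v : 'rV[C]_d) :=
  exists2 c : R, 0 <= c &
    forall n x, l ^+ n * sqn ((x *m v ^t*) 0 0) <= c * lform L n x.

Lemma lform_ge0 d (L : seq ('rV[C]_d * R)) n x :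
  {in L, forall p, 0 <= p.2} -> 0 <= lform L n x.
Proof.
move=> L0; rewrite /lform big_seq; apply: sumr_ge0 => p pL.
by rewrite mulr_ge0 ?sqn_ge0 // exprn_ge0 ?L0.
Qed.

Lemma dominatedD d (L : seq ('rV[C]_d * R)) l v w : 0 <= l ->
  dominated L l v -> dominated L l w -> dominated L l (v + w).
Proof.
move=> l0 [c c0 cv] [e e0 ew]; exists (2 * c + 2 * e).
  by rewrite addr_ge0 ?mulr_ge0.
move=> n x; have -> : (x *m (v + w) ^t*) 0 0 =
    (x *m v ^t*) 0 0 + (x *m w ^t*) 0 0.
  by rewrite linearD map_mxD mulmxDr mxE.
apply: le_trans (ler_wpM2l (exprn_ge0 _ l0) (sqnD _ _)) _.
move: (cv n x) (ew n x) => {cv ew}.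
by move: (l ^+ n) (sqn _) (sqn _) (lform _ _ _) => A B D F; lra.
Qed.

Lemma dominatedZ d (L : seq ('rV[C]_d * R)) l (k : C) v :
  dominated L l v -> dominated L l (k *: v).
Proof.
move=> [c c0 cv]; exists (sqn k * c); first by rewrite mulr_ge0 ?sqn_ge0.
move=> n x; have -> : (x *m (k *: v) ^t*) 0 0 =
    Num.conj k * (x *m v ^t*) 0 0.
  by rewrite linearZ map_mxZ -scalemxAr mxE.
by rewrite sqnM sqn_conj mulrCA -mulrA ler_wpM2l ?sqn_ge0.
Qed.

Lemma dominated_sum d (L : seq ('rV[C]_d * R)) l (I : finType)
    (v : I -> 'rV[C]_d) : 0 <= l ->
  {in L, forall p, 0 <= p.2} ->
  (forall i, dominated L l (v i)) -> dominated L l (\sum_i v i).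
Proof.
move=> l0 L0 vd.
apply: (big_ind (dominated L l)) => [|v1 v2|i _]; last exact: vd.
  exists 0 => // n x; rewrite mul0r.
  by rewrite trmx0 map_mx0 mulmx0 mxE sqn0 mulr0.
exact: dominatedD.
Qed.

Lemma dominated_le d (L : seq ('rV[C]_d * R)) l l' v :
  0 <= l -> l <= l' -> dominated L l' v -> dominated L l v.
Proof.
move=> l0 ll' [c c0 cv]; exists c => // n x; apply: le_trans (cv n x).
by rewrite ler_wpM2r ?sqn_ge0 // lerXn2r // nnegrE // (le_trans l0).
Qed.

Lemma dominated_cons d (L : seq ('rV[C]_d * R)) q l v : 0 <= q.2 ->
  dominated L l v -> dominated (q :: L) l v.
Proof.
move=> q0 [c c0 cv]; exists c => // n x; apply: le_trans (cv n x) _.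
by rewrite ler_wpM2l // [leRHS]big_cons lerDr mulr_ge0 ?sqn_ge0 ?exprn_ge0.
Qed.

Lemma dominated_head d (L : seq ('rV[C]_d * R)) q :
  {in L, forall p, 0 <= p.2} -> dominated (q :: L) q.2 q.1.
Proof.
move=> L0; exists 1 => // n x; rewrite mul1r [leRHS]big_cons lerDl.
exact: lform_ge0.
Qed.

(** The list increases, so the induction on it treats the largest weights first, and each new vector
    [v] has a weight [a] below all those already present. The third clause keeps [v] orthogonal to
    the basis vectors of smaller weight; the fourth bounds each basis vector by the form of the
    list. *)
Lemma orthonormal_adapted d (L : seq ('rV[C]_d * R)) :
  sorted (fun p q => p.2 <= q.2) L -> {in L, forall p, 0 <= p.2} ->
  exists r (W : 'M[C]_(r, d)) (m : 'I_r -> R),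
  [/\ W *m W ^t* = 1%:M,
      {in L, forall p, p.1 *m W ^t* *m W = p.1},
      {in L, forall p j, m j < p.2 -> (p.1 *m W ^t*) 0 j = 0},
      forall j, dominated L (m j) (row j W)
    & forall j, m j \in map snd L].
Proof.
elim: L => [|[v a] L IHL] sL L0.
  exists 0, 0, (fun=> 0); split=> [|//|//|[]|[]] //.
  by apply/matrixP => -[].
have trL : transitive (fun p q : 'rV[C]_d * R => p.2 <= q.2).
  by move=> ? ? ?; exact: le_trans.
have aL p : p \in L -> a <= p.2.
  by move: sL; rewrite /= path_sortedE // => /andP[/allP aL _] /aL.
have a0 : 0 <= a := L0 _ (mem_head _ _).
have {}L0 : {in L, forall p, 0 <= p.2}.
  by move=> p pL; apply: L0; rewrite inE pL orbT.
have [r [W [m [W1 WL Wz Wd mL]]]] := IHL (path_sorted sL) L0.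
have am j : a <= m j by have /mapP[p pL ->] := mL j; exact: aL.
have Wd' j : dominated ((v, a) :: L) (m j) (row j W) by exact: dominated_cons.
(* [u] is the part of [v] orthogonal to the rows found so far. If it is zero the basis stays;
   otherwise it is normalized to [w] and added with weight [a]. *)
set u := v - v *m W ^t* *m W.
have uW : u *m W ^t* = 0.
  by rewrite mulmxBl -[_ *m W *m _]mulmxA W1 mulmx1 subrr.
have vE : v = u + v *m W ^t* *m W by rewrite subrK.
have [u0|u0] := eqVneq u 0.
  exists r, W, m; split=> //.
  - move=> p; rewrite inE => /orP[/eqP->|/WL//].
    by rewrite /= [RHS]vE u0 add0r.
  - move=> p; rewrite inE => /orP[/eqP->|/Wz//] j /=.
    by rewrite ltNge am.
  - by move=> j; rewrite inE mL orbT.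
pose c := Num.sqrt (nsq u).
have nu0 : 0 < nsq u.
  by rewrite lt_neqAle nsq_ge0 eq_sym andbT; apply: contraNneq u0 => /nsq_eq0->.
have c0 : c != 0 by rewrite gt_eqF ?sqrtr_gt0.
have c2 : c * c = nsq u by rewrite -expr2 sqr_sqrtr ?ltW.
pose w : 'rV[C]_d := (c^-1)%:C *: u.
have wtr : w ^t* = (c^-1)%:C *: u ^t*.
  by rewrite linearZ map_mxZ /= conjC_real.
have uw : u *m w ^t* = c%:C%:M.
  rewrite wtr -scalemxAr nsqE scale_scalar_mx -rmorphM -c2 mulrA mulVf //.
  by rewrite mul1r.
have ww : w *m w ^t* = 1%:M.
  by rewrite {1}/w -scalemxAl uw scale_scalar_mx -rmorphM mulVf.
have wW : w *m W ^t* = 0 by rewrite -scalemxAl uW scaler0.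
have Ww : W *m w ^t* = 0.
  by rewrite -[W]trmxCK -trmxCM wW trmx0 map_mx0.
have vw : v *m w ^t* = c%:C%:M.
  by rewrite {1}vE mulmxDl uw -mulmxA Ww mulmx0 addr0.
have pw p : p \in L -> p.1 *m w ^t* = 0.
  by move=> pL; rewrite -(WL p pL) -[_ *m W *m _]mulmxA Ww mulmx0.
pose m' (i : 'I_(1 + r)) :=
  match fintype.split i with inl _ => a | inr j => m j end.
have WtE : (col_mx w W) ^t* = row_mx (w ^t*) (W ^t*).
  by rewrite tr_col_mx map_row_mx.
exists (1 + r)%N, (col_mx w W), m'; rewrite WtE; split.
- by rewrite mul_col_row ww wW Ww W1 -scalar_mx_block.
- move=> p pL; rewrite mul_mx_row mul_row_col.
  move: pL; rewrite inE => /orP[/eqP->|pL] /=.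
    rewrite vw mul_scalar_mx scalerA -rmorphM divff // rmorph1 scale1r.
    by rewrite [RHS]vE.
  by rewrite (pw p pL) mul0mx add0r (WL p pL).
- move=> p pL j; rewrite /m' mul_mx_row mxE; case: (fintype.split j) => k.
    move: pL; rewrite inE => /orP[/eqP->|/pw->] /=; first by rewrite ltxx.
    by rewrite mxE.
  move: pL; rewrite inE => /orP[/eqP->|/Wz] /=; last exact.
  by rewrite ltNge am.
- move=> j; rewrite /m'; case: (split_ordP j) => k ->.
    rewrite ?ord1 rowKu row_id.
    (* [w] is a multiple of [v] minus its projection: [v] is dominated at its own weight [a], and so
       is the projection, the old rows having weights at least [a]. *)
    apply: dominatedZ; apply: dominatedD => //.
      exact: (dominated_head (v, a)).
    rewrite -scaleN1r; apply: dominatedZ.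
    rewrite mulmx_sum_row; apply: dominated_sum; first exact: a0.
      by move=> p; rewrite inE => /orP[/eqP->|/L0].
    move=> i.
    by apply: dominatedZ; apply: dominated_le (Wd' i).
  by rewrite rowKd.
- move=> j; rewrite /m'; case: (fintype.split j) => k;
  by rewrite inE ?eqxx // mL orbT.
Qed.

End GramSchmidt.

(** * A basis adapted to two spectral families, and a gap estimate for powers *)

Section TwoFamilies.
Variable R : rcfType.
Notation C := R[i].

Lemma wform_lform r d (U : 'M[C]_(r, d)) (a : 'I_r -> R) n (x : 'rV[C]_d) :
  lform [seq (row i U, a i) | i <- enum 'I_r] n x =
    wform U (fun i => a i ^+ n) x.
Proof.
rewrite /lform big_map big_enum; apply: eq_bigr => i _ /=.
suff -> : (x *m (row i U) ^t*) 0 0 = (x *m U ^t*) 0 i by [].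
by rewrite !mxE; apply: eq_bigr => k _; rewrite !mxE.
Qed.

(** Gram-Schmidt is run on the eigenpairs of both families, merged and sorted by eigenvalue. The
    bound [c] comes before [n]: this uniformity makes the [n]-th roots converge. *)
Lemma common_adapted_basis d (U V : 'M[C]_d) (a b : 'I_d -> R) :
  U *m U ^t* = 1%:M -> V *m V ^t* = 1%:M ->
  (forall i, 0 <= a i) -> (forall i, 0 <= b i) ->
  exists r (W : 'M[C]_(r, d)) (m : 'I_r -> R) (c : R),
  [/\ [/\ W *m W ^t* = 1%:M, (W ^t*) *m W = 1%:M, 0 <= c & forall j, 0 <= m j],
      forall n x,
        wform U (fun i => a i ^+ n) x <= wform W (fun j => m j ^+ n) x,
      forall n x,
        wform V (fun i => b i ^+ n) x <= wform W (fun j => m j ^+ n) x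
    & forall n x, wform W (fun j => m j ^+ n) x <=
        c * (wform U (fun i => a i ^+ n) x + wform V (fun i => b i ^+ n) x)].
Proof.
move=> U1 V1 a0 b0.
pose L0 := [seq (row i U, a i) | i <- enum 'I_d] ++
  [seq (row i V, b i) | i <- enum 'I_d].
pose leq2 (p q : 'rV[C]_d * R) := p.2 <= q.2.
pose L := sort leq2 L0.
have lformE n x : lform L n x =
    wform U (fun i => a i ^+ n) x + wform V (fun i => b i ^+ n) x.
  rewrite -!wform_lform /lform -big_cat; apply: perm_big.
  by rewrite perm_sort.
have UL i : (row i U, a i) \in L.
  by rewrite mem_sort mem_cat map_f ?mem_enum.
have VL i : (row i V, b i) \in L.
  by rewrite mem_sort mem_cat [X in _ || X]map_f ?mem_enum ?orbT.
have L_ge0 : {in L, forall p, 0 <= p.2}.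
  by move=> p; rewrite mem_sort mem_cat => /orP[] /mapP[i _ ->] /=.
have [|r [W [m [W1 WL Wz Wd mL]]]] := orthonormal_adapted (L := L) _ L_ge0.
  by apply: (sort_sorted (leT := leq2)) => p q; exact: le_total.
have m0 j : 0 <= m j by have /mapP[p pL ->] := mL j; exact: L_ge0.
have UW : U *m W ^t* *m W = U.
  by apply/row_matrixP => i; rewrite !row_mul (WL _ (UL i)).
have VW : V *m W ^t* *m W = V.
  by apply/row_matrixP => i; rewrite !row_mul (WL _ (VL i)).
(* The rows of [W] span the space because they span the rows of the unitary [U]. *)
have W2 : (W ^t*) *m W = 1%:M.
  by have := congr1 (mulmx (U ^t*)) UW; rewrite !mulmxA (unitary_trC U1) mul1mx.
have [c c0 cW] : exists2 c : R, 0 <= c &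
    forall n x, wform W (fun j => m j ^+ n) x <= c * lform L n x.
  have /choice[c cP] : forall j, exists c : R, 0 <= c /\
      forall n x, m j ^+ n * sqn ((x *m W ^t*) 0 j) <= c * lform L n x.
    move=> j; have [c c0 cP] := Wd j; exists c; split=> // n x.
    apply: le_trans (cP n x).
    suff -> : (x *m (row j W) ^t*) 0 0 = (x *m W ^t*) 0 j by [].
    by rewrite !mxE; apply: eq_bigr => k _; rewrite !mxE.
  (* The domination constants of the single rows of [W] add up. *)
  exists (\sum_j c j) => [|n x]; first by apply: sumr_ge0 => j _; case: (cP j).
  by rewrite mulr_suml; apply: ler_sum => j _; case: (cP j).
exists r, W, m, c; split; first by split.
- move=> n x; apply: wform_le => // k j mak.
  by have := Wz _ (UL k) j mak; rewrite -row_mul mxE.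
- move=> n x; apply: wform_le => // k j mbk.
  by have := Wz _ (VL k) j mbk; rewrite -row_mul mxE.
- by move=> n x; rewrite -lformE.
Qed.

(** Each of the [n.+1] terms in the factorization of [x ^+ n.+1 - y ^+ n.+1] by [x - y] is at least
    [y ^+ n], whence [(x - y) * y ^+ n * n.+1%:R <= x ^+ n.+1]. Multiplying the last hypothesis by
    [(x - y) ^+ 2 * n.+1%:R] and cancelling [x ^+ n] gives the claim. *)
Lemma exprn_gap (x y g c : R) n : 0 <= y -> y <= x -> 0 <= g -> 0 <= c ->
  x ^+ n * g <= c * y ^+ n -> (x - y) ^+ 2 * g * n.+1%:R <= c * x ^+ 2.
Proof.
move=> y0 yx g0 c0 xg.
have [x0|xn0] := eqVneq x 0.
  have -> : y = 0 by apply/eqP; rewrite eq_le y0 -x0 yx.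
  by rewrite x0 subr0 expr0n /= !mul0r mulr0.
have x0 : 0 < x by rewrite lt_def xn0 (le_trans y0).
have xy : (x - y) * y ^+ n * n.+1%:R <= x ^+ n.+1.
  apply: (@le_trans _ _ (x ^+ n.+1 - y ^+ n.+1)); last first.
    by rewrite gerBl exprn_ge0.
  rewrite subrXX -mulrA ler_wpM2l ?subr_ge0 //.
  have -> : y ^+ n * n.+1%:R = \sum_(i < n.+1) y ^+ n.
    by rewrite sumr_const card_ord mulr_natr.
  apply: ler_sum => i _; rewrite /=.
  have -> : y ^+ n = y ^+ (n - i) * y ^+ i by rewrite -exprD subnK // -ltnS.
  apply: ler_wpM2r; first exact: exprn_ge0.
  by apply: lerXn2r; rewrite ?nnegrE // ltW.
rewrite -(ler_pM2l (exprn_gt0 n x0)).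
have -> : x ^+ n * ((x - y) ^+ 2 * g * n.+1%:R) =
  (x - y) ^+ 2 * n.+1%:R * (x ^+ n * g) by ring.
apply: (@le_trans _ _ ((x - y) ^+ 2 * n.+1%:R * (c * y ^+ n))).
  by rewrite ler_wpM2l // mulr_ge0 ?sqr_ge0.
have -> : (x - y) ^+ 2 * n.+1%:R * (c * y ^+ n) =
  c * (x - y) * ((x - y) * y ^+ n * n.+1%:R) by ring.
have -> : x ^+ n * (c * x ^+ 2) = c * x * x ^+ n.+1.
  by rewrite [x ^+ n.+1]exprS; ring.
apply: ler_pM => //; first by rewrite mulr_ge0 ?subr_ge0.
- by rewrite !mulr_ge0 ?subr_ge0 ?exprn_ge0.
- by rewrite ler_wpM2l // gerBl.
Qed.

(** * Squared Frobenius norm and convergence of spectral matrices *)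

Definition fro m n (X : 'M[C]_(m, n)) : R := \sum_i nsq (row i X).

Lemma froE m n (X : 'M[C]_(m, n)) : fro X = \sum_i \sum_j sqn (X i j).
Proof. by apply: eq_bigr => i _; apply: eq_bigr => j _; rewrite mxE. Qed.

Lemma fro_trC m n (X : 'M[C]_(m, n)) : fro (X ^t*) = fro X.
Proof.
rewrite !froE exchange_big; apply: eq_bigr => i _; apply: eq_bigr => j _ /=.
by rewrite !mxE sqn_conj.
Qed.

Lemma fro_isomr m n r (X : 'M[C]_(m, n)) (T : 'M[C]_(r, n)) :
  (T ^t*) *m T = 1%:M -> fro (X *m T ^t*) = fro X.
Proof. by move=> T1; apply: eq_bigr => i _; rewrite row_mul nsq_isom. Qed.

Lemma fro_isoml m n r (X : 'M[C]_(n, m)) (T : 'M[C]_(r, n)) :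
  (T ^t*) *m T = 1%:M -> fro (T *m X) = fro X.
Proof.
by move=> T1; rewrite -fro_trC trmxCM fro_isomr // fro_trC.
Qed.

Lemma sqn_le_fro m n (X : 'M[C]_(m, n)) i j : sqn (X i j) <= fro X.
Proof.
rewrite froE (bigD1 i) //= (bigD1 j) //= -addrA lerDl addr_ge0 //.
  by apply: sumr_ge0 => k _; exact: sqn_ge0.
by apply: sumr_ge0 => k _; apply: sumr_ge0 => l _; exact: sqn_ge0.
Qed.

(** [fro] is invariant under isometries on either side. Multiplying by [U] on the left and [W ^t*]
    on the right leaves, with [G = U *m W ^t*], the entries [(b i - m j) * G i j]. *)
Lemma specmx_dist r d (U : 'M[C]_d) (W : 'M[C]_(r, d)) (b : 'I_d -> R)
    (m : 'I_r -> R) : U *m U ^t* = 1%:M -> W *m W ^t* = 1%:M ->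
    (W ^t*) *m W = 1%:M ->
  fro (specmx U (fun i => (b i)%:C) - specmx W (fun j => (m j)%:C)) =
  \sum_i \sum_j (b i - m j) ^+ 2 * sqn ((U *m W ^t*) i j).
Proof.
move=> U1 W1 W2.
rewrite -(fro_isoml _ (unitary_trC U1)) -(fro_isomr _ W2) froE.
rewrite mulmxBr mulmxBl /specmx !mulmxA U1 mul1mx.
rewrite -[_ *m W *m _]mulmxA W1 mulmx1 -[_ *m U *m _]mulmxA.
move: (U *m W ^t*) => G.
apply: eq_bigr => i _; apply: eq_bigr => j _.
rewrite mxE [(- _ : matrix _ _ _) _ _]mxE mul_diag_mx mul_mx_diag !mxE.
by rewrite [G i j * _]mulrC -mulrBl -rmorphB sqnM sqn_real.
Qed.

End TwoFamilies.

Lemma specmx_cvg (R : realType) r d (W : 'M[R[i]]_(r, d)) (m : 'I_r -> R)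
    (B : nat -> 'M[R[i]]_d) (c e : R) :
  W *m W ^t* = 1%:M -> (W ^t*) *m W = 1%:M -> (forall j, 0 <= m j) ->
  0 <= c -> 0 <= e ->
  (forall n, (0 < n)%N -> exists (U : 'M[R[i]]_d) (b : 'I_d -> R),
    [/\ U *m U ^t* = 1%:M, forall i, 0 <= b i,
       B n = specmx U (fun i => (b i)%:C),
       forall x, wform U (fun i => b i ^+ n) x <=
         c * wform W (fun j => m j ^+ n) x
     & forall x, wform W (fun j => m j ^+ n) x <=
         e * wform U (fun i => b i ^+ n) x]) ->
  forall z : R[i], 0 < z -> exists N, forall n i j, (N <= n)%N ->
    `|B n i j - specmx W (fun j => (m j)%:C) i j| < z.
Proof.
move=> W1 W2 m0 c0 e0 Bspec; set M := specmx W _.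
(* [mu] bounds every [m j] and, uniformly in [n], every [b i]; the factor [1 + c] absorbs [c], since
   [c <= (1 + c) ^+ n] for [n > 0]. *)
pose mu := (1 + c) * \sum_j m j.
pose K := \sum_(i < d) \sum_(j < r) (c + e) * mu ^+ 2.
have summ0 : 0 <= \sum_j m j by exact: sumr_ge0.
have m_le j : m j <= \sum_j m j.
  by rewrite (bigD1 j) //= lerDl; apply: sumr_ge0.
have mmu j : m j <= mu.
  by apply: le_trans (m_le j) _; rewrite ler_peMl // lerDl.
have BM n : (0 < n)%N -> fro (B n - M) * n.+1%:R <= K.
  move=> n0; have [U [b [U1 b0 -> Uc We]]] := Bspec n n0.
  have row_nsq k (V : 'M[R[i]]_(k, d)) i : V *m V ^t* = 1%:M ->
      nsq (row i V) = 1.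
    by move=> V1; apply: complexI; rewrite nsq_row V1 mxE eqxx.
  (* The first form inequality is tested on the eigenvector [row j W], keeping only the term [i];
     the second one is tested below on [row i U]. *)
  have Uci i j : b i ^+ n * sqn ((U *m W ^t*) i j) <= c * m j ^+ n.
    have := Uc (row j W).
    have -> : wform W (fun j => m j ^+ n) (row j W) = m j ^+ n.
      rewrite /wform (bigD1 j) //= big1 ?addr0 => [|k kj].
        by rewrite -row_mul W1 !mxE eqxx /= sqn_real expr1n mulr1.
      by rewrite -row_mul W1 !mxE eq_sym (negPf kj) sqn0 mulr0.
    apply: le_trans; rewrite /wform (bigD1 i) //=.
    have -> : (row j W *m U ^t*) 0 i = Num.conj ((U *m W ^t*) i j).
      have -> : row j W *m U ^t* = row j ((U *m W ^t*) ^t*).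
        by rewrite trmxCM trmxCK row_mul.
      by rewrite 3!mxE.
    rewrite sqn_conj lerDl; apply: sumr_ge0 => k _.
    by rewrite mulr_ge0 ?sqn_ge0 ?exprn_ge0.
  have Wei i j : m j ^+ n * sqn ((U *m W ^t*) i j) <= e * b i ^+ n.
    have := We (row i U).
    have -> : wform U (fun i => b i ^+ n) (row i U) = b i ^+ n.
      rewrite /wform (bigD1 i) //= big1 ?addr0 => [|k ki].
        by rewrite -row_mul U1 !mxE eqxx /= sqn_real expr1n mulr1.
      by rewrite -row_mul U1 !mxE eq_sym (negPf ki) sqn0 mulr0.
    apply: le_trans; rewrite /wform (bigD1 j) //=.
    rewrite -row_mul [row _ _ _ _]mxE lerDl; apply: sumr_ge0 => k _.
    by rewrite mulr_ge0 ?sqn_ge0 ?exprn_ge0.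
  have bmu i : b i <= mu.
    rewrite -(@ler_pXn2r _ n) ?nnegrE ?mulr_ge0 ?addr_ge0 //.
    have := Uc (row i U).
    have -> : wform U (fun i => b i ^+ n) (row i U) = b i ^+ n.
      rewrite /wform (bigD1 i) //= big1 ?addr0 => [|k ki].
        by rewrite -row_mul U1 !mxE eqxx /= sqn_real expr1n mulr1.
      by rewrite -row_mul U1 !mxE eq_sym (negPf ki) sqn0 mulr0.
    move=> /le_trans; apply; rewrite /mu exprMn.
    apply: ler_pM => //; first by apply: wform_ge0 => j; exact: exprn_ge0.
      apply: le_trans (_ : 1 + c <= _); first by rewrite lerDr.
      by rewrite -[leLHS]expr1 ler_weXn2l // lerDl.
    have <- : nsq (row i U *m W ^t*) * (\sum_j m j) ^+ n = (\sum_j m j) ^+ n.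
      by rewrite nsq_isom // row_nsq // mul1r.
    rewrite /wform /nsq mulr_suml; apply: ler_sum => j _.
    rewrite mulrC; apply: ler_wpM2l; first exact: sqn_ge0.
    by apply: lerXn2r; rewrite ?nnegrE.
  rewrite specmx_dist // mulr_suml; apply: ler_sum => i _.
  rewrite mulr_suml; apply: ler_sum => j _.
  (* The larger of [b i] and [m j] plays the role of [x] in [exprn_gap], with constant [c] or [e];
     hence [c + e] in [K]. *)
  have [mb|/ltW bm] := leP (m j) (b i).
    apply: le_trans (exprn_gap (m0 j) mb (sqn_ge0 _) c0 (Uci i j)) _.
    apply: ler_pM; rewrite ?sqr_ge0 ?lerDl // lerXn2r ?nnegrE //.
    by rewrite mulr_ge0 ?addr_ge0.
  rewrite -sqrrN opprB.
  apply: le_trans (exprn_gap (b0 i) bm (sqn_ge0 _) e0 (Wei i j)) _.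
  apply: ler_pM; rewrite ?sqr_ge0 ?lerDr // lerXn2r ?nnegrE //.
  by rewrite mulr_ge0 ?addr_ge0.
move=> z z0.
(* In the order of [R[i]], a positive number is real. *)
have zr : z = (complex.Re z)%:C by rewrite RRe_real // gtr0_real.
have rz0 : 0 < complex.Re z by move: z0; rewrite zr ltcR.
have [N KN] : exists N : nat, K / complex.Re z ^+ 2 < N%:R.
  exists (Num.bound (K / complex.Re z ^+ 2)); apply: archi_boundP.
  rewrite divr_ge0 ?sqr_ge0 //; apply: sumr_ge0 => i _; apply: sumr_ge0 => j _.
  by rewrite mulr_ge0 ?addr_ge0 ?sqr_ge0.
exists N.+1 => n i j Nn; rewrite zr normc_def ltcR.
rewrite -(ltr_pXn2r (n := 2)) ?nnegrE ?sqrtr_ge0 ?ltW //.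
rewrite sqr_sqrtr ?addr_ge0 ?sqr_ge0 //.
have n0 : (0 < n)%N by apply: leq_trans Nn.
have := sqn_le_fro (B n - M) i j; rewrite mxE [(- M) i j]mxE.
move=> /le_lt_trans; apply.
rewrite -(ltr_pM2r (x := n.+1%:R)) ?ltr0n //; apply: le_lt_trans (BM n n0) _.
rewrite mulrC -ltr_pdivrMr ?exprn_gt0 //; apply: lt_trans KN _.
by rewrite ltr_nat (leq_trans Nn).
Qed.

(** * The absolute value of a matrix and the mixed Cauchy-Schwarz inequality *)

Section AbsoluteValue.
Variable R : rcfType.
Notation C := R[i].

Definition rform d (X : 'M[C]_d) (x : 'rV[C]_d) : R :=
  complex.Re ((x *m X *m x ^t*) 0 0).

Lemma nsq_Re n (y : 'rV[C]_n) : nsq y = complex.Re ((y *m y ^t*) 0 0).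
Proof. by rewrite nsqE mxE eqxx mulr1n. Qed.

Lemma rform_specmx r d (W : 'M[C]_(r, d)) (a : 'I_r -> R) (x : 'rV[C]_d) :
  rform (specmx W (fun i => (a i)%:C)) x = wform W a x.
Proof. by rewrite /rform specmx_form mxE eqxx mulr1n. Qed.

Lemma specmx0 r d (W : 'M[C]_(r, d)) : specmx W (fun=> 0) = 0.
Proof.
rewrite /specmx; have -> : \row_i (0 : C) = 0 :> 'rV[C]_r.
  by apply/rowP => i; rewrite !mxE.
by rewrite linear0 mulmx0 mul0mx.
Qed.

Lemma specmxB r d (W : 'M[C]_(r, d)) (g h : 'I_r -> C) :
  specmx W g - specmx W h = specmx W (fun i => g i - h i).
Proof.
rewrite /specmx -mulmxBl -mulmxBr.
have <- : diag_mx (\row_i g i) - diag_mx (\row_i h i) =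
    diag_mx (\row_i (g i - h i)); last by [].
by rewrite -linearB; apply: congr1; apply/rowP => i; rewrite !mxE.
Qed.

Lemma mulmx_trC_eq0 m n (X : 'M[C]_(m, n)) : X *m X ^t* = 0 -> X = 0.
Proof.
move=> X0; apply/row_matrixP => i; rewrite row0; apply: nsq_eq0.
by apply: complexI; rewrite nsq_row X0 mxE.
Qed.

Lemma diag_mx_commP m n (X : 'M[C]_(m, n)) (v : 'rV[C]_n) (w : 'rV[C]_m) :
  X *m diag_mx v = diag_mx w *m X <->
  forall i j, X i j * v 0 j = w 0 i * X i j.
Proof.
rewrite mul_mx_diag mul_diag_mx; split=> [/matrixP vw i j|vw].
  by have := vw i j; rewrite mxE [RHS]mxE.
by apply/matrixP => i j; rewrite mxE [RHS]mxE.
Qed.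

(** In the bases [U] and [V] the hypothesis reads [X i j * s j = t i * X i j], so [s j = t i]
    wherever [X i j] is nonzero; there [f (s j) = f (t i)] for an arbitrary function [f]. *)
Lemma specmx_intertwine d (A U V : 'M[C]_d) (s t : 'I_d -> C) (f : C -> C) :
  U *m U ^t* = 1%:M -> V *m V ^t* = 1%:M ->
  A *m specmx U s = specmx V t *m A ->
  A *m specmx U (fun i => f (s i)) = specmx V (fun i => f (t i)) *m A.
Proof.
move=> U1 V1; have V2 := unitary_trC V1; have U2 := unitary_trC U1.
pose X := V *m A *m U ^t*.
have Al g : V *m (A *m specmx U g) *m U ^t* = X *m diag_mx (\row_i g i).
  by rewrite /specmx !mulmxA -[_ *m U *m _]mulmxA U1 mulmx1.
have Ar g : V *m (specmx V g *m A) *m U ^t* = diag_mx (\row_i g i) *m X.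
  by rewrite /specmx !mulmxA V1 mul1mx.
have back Y : Y = V ^t* *m (V *m Y *m U ^t*) *m U.
  by rewrite !mulmxA V2 mul1mx -mulmxA U2 mulmx1.
move=> /(congr1 (fun Y => V *m Y *m U ^t*)); rewrite Al Ar => XE.
rewrite [LHS]back [RHS]back Al Ar; clearbody X.
apply: (congr1 (fun Y => V ^t* *m Y *m U)).
apply/diag_mx_commP => i j; have /diag_mx_commP/(_ i j) := XE.
rewrite !mxE; have [->|X0] := eqVneq (X i j) 0; first by rewrite !mulr0 !mul0r.
by rewrite mulrC => /(mulIf X0) ->; rewrite mulrC.
Qed.

Lemma gram_psd d n (A : 'M[C]_(n, d)) (x : 'rV[C]_d) :
  0 <= (x *m (A ^t* *m A) *m x ^t*) 0 0.
Proof.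
have -> : x *m (A ^t* *m A) *m x ^t* = (x *m A ^t*) *m (x *m A ^t*) ^t*.
  by rewrite trmxCM trmxCK !mulmxA.
by rewrite nsqE mxE eqxx mulr1n ler0c nsq_ge0.
Qed.

Lemma mxroot_spectral d (S U : 'M[C]_d) s n : spectral_of S U s ->
  exists b : 'I_d -> R, [/\ forall i, 0 <= b i,
    mxroot n S = specmx U (fun i => (b i)%:C)
    & (0 < n)%N -> forall i, b i ^+ n = s i].
Proof.
move=> [U1 s0 _ fS]; exists (fun i => complex.Re (n.-root (s i)%:C : C)).
split=> [i||n0 i].
- rewrite -ler0c -rootC_real //; case: n => [|n]; first by rewrite root0C.
  by rewrite rootC_ge0 // ler0c.
- by rewrite /mxroot fS; apply: eq_specmx => i; rewrite -rootC_real.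
- by apply: complexI; rewrite rmorphXn /= -rootC_real // rootCK.
Qed.

Lemma absmx_spectral d (A : 'M[C]_d) : exists (U : 'M[C]_d) (p : 'I_d -> R),
  [/\ U *m U ^t* = 1%:M, forall i, 0 <= p i,
      absmx A = specmx U (fun i => (p i)%:C)
    & A ^t* *m A = specmx U (fun i => (p i ^+ 2)%:C)].
Proof.
have [||U [s Us]] := @psd_spectral_of R d (A ^t* *m A).
- by rewrite trmxCM trmxCK.
- exact: gram_psd.
have [p [p0 pE p2]] := mxroot_spectral 2 Us; have [U1 s0 SE _] := Us.
exists U, p; split; [exact: U1|exact: p0|exact: pE|rewrite SE].
by apply: eq_specmx => i; rewrite p2.
Qed.

(** A sum of nonnegative terms [p i * sqn _] that is at most 0 has all its terms zero. So the sum
    with weights [p i ^+ 2], which is the squared norm of [z *m A ^t*], vanishes too. *)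
Lemma absmx_ker d (A : 'M[C]_d) (z : 'rV[C]_d) :
  rform (absmx A) z <= 0 -> z *m A ^t* = 0.
Proof.
have [U [p [U1 p0 -> AA]]] := absmx_spectral A; rewrite rform_specmx => zp.
apply: nsq_eq0; have -> : nsq (z *m A ^t*) = wform U (fun i => p i ^+ 2) z.
  by rewrite -rform_specmx -AA /rform nsq_Re trmxCM trmxCK !mulmxA.
have : wform U p z = 0 by apply: le_anti; rewrite zp wform_ge0.
move=> /eqP; rewrite psumr_eq0 => [/allP zp0|i _]; last first.
  by rewrite mulr_ge0 ?sqn_ge0.
apply: big1 => i _; have := zp0 i; rewrite mem_index_enum => /(_ isT) /eqP zpi.
by rewrite expr2 -mulrA zpi mulr0.
Qed.

(** Expand the squared norm of [y *m G - x *m A *m H]: the square terms are the forms of [P] and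
    [Q], the cross terms are [x *m A *m y ^t*] and its conjugate. *)
Lemma factored_mixed_form d (A G H P Q : 'M[C]_d) (x y : 'rV[C]_d) :
  G ^t* = G -> H ^t* = H -> G *m G = P -> A *m (H *m G) = A ->
  A *m (H *m H) *m A ^t* = Q ->
  2 * complex.Re ((x *m A *m y ^t*) 0 0) <= rform P y + rform Q x.
Proof.
move=> Gh Hh GG AHG AHHA.
have Et : (y *m G - x *m A *m H) ^t* = G *m y ^t* - H *m (A ^t* *m x ^t*).
  rewrite (trmxCB (y *m G) (x *m A *m H)) (trmxCM y G) (trmxCM (x *m A) H).
  by rewrite (trmxCM x A) Gh Hh.
have yy : y *m G *m (G *m y ^t*) = y *m P *m y ^t*.
  by rewrite -GG !mulmxA.
have xy : x *m A *m H *m (G *m y ^t*) = x *m A *m y ^t*.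
  by rewrite -[in RHS]AHG !mulmxA.
have yx : y *m G *m (H *m (A ^t* *m x ^t*)) = (x *m A *m y ^t*) ^t*.
  rewrite -xy (trmxCM (x *m A *m H)) (trmxCM G) (trmxCM (x *m A)) (trmxCM x).
  by rewrite Gh Hh (trmxCK y).
have xx : x *m A *m H *m (H *m (A ^t* *m x ^t*)) =
    x *m Q *m x ^t*.
  by rewrite -AHHA !mulmxA.
have := nsq_ge0 (y *m G - x *m A *m H); rewrite nsq_Re Et mulmxBr.
rewrite (mulmxBl (y *m G)) (mulmxBl (y *m G)) yy xy yx xx.
rewrite /rform; move: (y *m P *m y ^t*) (x *m Q *m x ^t*) (x *m A *m y ^t*).
clear => Y X T.
have -> : complex.Re ((Y - T - (T ^t* - X)) 0 0) =
    complex.Re (Y 0 0) + complex.Re (X 0 0) - 2 * complex.Re (T 0 0).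
  by rewrite !mxE !(ReD, ReN); case: (T 0 0) => p q /=; ring.
by rewrite subr_ge0.
Qed.

(* The difference of the two sides is the squared norm of
   [y |A|^{1/2} - x A |A|^{-1/2}], because [A |A|^{-1} A^* = |A^*|]. *)
Lemma absmx_mixed d (A : 'M[C]_d) (x y : 'rV[C]_d) :
  2 * complex.Re ((x *m A *m y ^t*) 0 0) <=
    rform (absmx A) y + rform (absmx (A ^t*)) x.
Proof.
have [U [p [U1 p0 PE AA]]] := absmx_spectral A.
have [V [q [V1 q0 QE AAt]]] := absmx_spectral (A ^t*).
rewrite trmxCK in AAt.
pose g i := Num.sqrt (p i).
pose G := specmx U (fun i => (g i)%:C).
(* As [0^-1 = 0], [H] is the pseudo-inverse of [G]. *)
pose H := specmx U (fun i => ((g i)^-1)%:C).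
have g2 i : g i * g i = p i by rewrite -expr2 sqr_sqrtr.
have Gh : G ^t* = G.
  by rewrite specmx_trC; apply: eq_specmx => i; rewrite conjC_real.
have Hh : H ^t* = H.
  by rewrite specmx_trC; apply: eq_specmx => i; rewrite conjC_real.
have GG : G *m G = absmx A.
  by rewrite PE (specmxM _ _ U1); apply: eq_specmx => i; rewrite -rmorphM g2.
have AHG : A *m (H *m G) = A.
  (* [Z] projects onto the kernel of [G], where [A ^t* *m A] vanishes; thus [Z *m A ^t*] has zero
     Gram matrix. *)
  pose Z := 1%:M - H *m G.
  have ZE : Z = specmx U (fun i => (1 - (g i)^-1 * g i)%:C).
    rewrite /Z -(specmx1 (unitary_trC U1)) (specmxM _ _ U1) specmxB.
    by apply: eq_specmx => i; rewrite rmorphB rmorphM.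
  have Zh : Z ^t* = Z.
    by rewrite ZE specmx_trC; apply: eq_specmx => i; rewrite conjC_real.
  suff : Z *m A ^t* = 0.
    move=> /(congr1 (fun Y : 'M[C]_d => Y ^t*)); rewrite trmxCM trmxCK Zh trmx0.
    rewrite map_mx0 mulmxBr mulmx1 => /eqP; rewrite subr_eq0 => /eqP {2}->.
    by [].
  apply: mulmx_trC_eq0; rewrite trmxCM trmxCK mulmxA -(mulmxA Z) AA Zh ZE.
  rewrite !(specmxM _ _ U1) -[RHS](specmx0 U); apply: eq_specmx => i.
  rewrite -!rmorphM; have [gi0|gi0] := eqVneq (g i) 0.
    by rewrite -g2 gi0 !(mulr0, mul0r, expr0n) /= ?mul0r ?mulr0.
  by rewrite mulVf // subrr mulr0.
have AHHA : A *m (H *m H) *m A ^t* = absmx (A ^t*).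
  (* Written as a function of the eigenvalues of [A ^t* *m A], [H *m H] can be moved across [A] and
     becomes the same function of [A *m A ^t*]. *)
  have -> : H *m H = specmx U (fun i => (2.-root ((p i ^+ 2)%:C : C))^-1).
    rewrite (specmxM _ _ U1); apply: eq_specmx => i.
    by rewrite (rootC_sqr (p0 i)) -rmorphM -invfM g2 fmorphV.
  rewrite (specmx_intertwine (V := V) (t := fun i => (q i ^+ 2)%:C)
    (fun z => (2.-root z)^-1) U1 V1); last by rewrite -AA -AAt mulmxA.
  rewrite -mulmxA AAt (specmxM _ _ V1) QE; apply: eq_specmx => i.
  rewrite (rootC_sqr (q0 i)) -fmorphV -rmorphM; have [->|qi0] := eqVneq (q i) 0.
    by rewrite invr0 mul0r.
  by rewrite expr2 mulKf.
exact: (factored_mixed_form _ _ Gh Hh GG AHG AHHA).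
Qed.

End AbsoluteValue.

(** * Identification of Kato's limit *)

Lemma maxmod_dominates (R : realType) (d : nat) (A : 'M[R[i]]_d) :
  [/\ exists (U : 'M[R[i]]_d) (s : 'I_d -> R), spectral_of (maxmod A) U s,
      forall x, rform (absmx A) x <= rform (maxmod A) x
    & forall x, rform (absmx (A ^t*)) x <= rform (maxmod A) x].
Proof.
have [U [p [U1 p0 PE _]]] := absmx_spectral A.
have [V [q [V1 q0 QE _]]] := absmx_spectral (A ^t*).
have [r [W [m [c [[W1 W2 c0 m0] UW VW WUV]]]]] :=
  common_adapted_basis U1 V1 p0 q0.
have maxmodE : maxmod A = specmx W (fun j => (m j)%:C).
  apply: lim_mx_entrywise.
  (* The constant 2 arises because |A|^n and |A^*|^n are each below the [n]-th power of the
     limit. *)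
  apply: (specmx_cvg (c := 2) (e := c)) => // n n0.
  pose S : 'M[R[i]]_d := absmx A ^+ n + absmx (A ^t*) ^+ n.
  have SE : S = specmx U (fun i => (p i ^+ n)%:C) +
      specmx V (fun i => (q i ^+ n)%:C).
    rewrite /S PE QE (specmxX _ _ U1 (unitary_trC U1)).
    rewrite (specmxX _ _ V1 (unitary_trC V1)).
    suff E (Z : 'M[R[i]]_d) (a : 'I_d -> R) :
        specmx Z (fun i => (a i)%:C ^+ n) = specmx Z (fun i => (a i ^+ n)%:C).
      by rewrite !E.
    by apply: eq_specmx => i; rewrite rmorphXn.
  have Sform x : x *m S *m x ^t* =
      ((wform U (fun i => p i ^+ n) x + wform V (fun i => q i ^+ n) x)%:C)%:M.
    by rewrite SE mulmxDr mulmxDl !specmx_form -raddfD -rmorphD.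
  have [||B [s Bs]] := @psd_spectral_of R d S.
  - rewrite SE linearD map_mxD !specmx_trC.
    suff E (Z : 'M[R[i]]_d) (a : 'I_d -> R) :
        specmx Z (fun i => Num.conj (a i)%:C) = specmx Z (fun i => (a i)%:C).
      by rewrite !E.
    by apply: eq_specmx => i; rewrite conjC_real.
  - move=> x; rewrite Sform mxE eqxx mulr1n ler0c addr_ge0 //;
    by apply: wform_ge0 => i; exact: exprn_ge0.
  have [b [b0 bE bn]] := mxroot_spectral n Bs; have [B1 s0 SB _] := Bs.
  have bform x : wform B (fun i => b i ^+ n) x =
      wform U (fun i => p i ^+ n) x + wform V (fun i => q i ^+ n) x.
    rewrite -(rform_specmx B (fun i => b i ^+ n)).
    have -> : specmx B (fun i => (b i ^+ n)%:C) = S.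
      by rewrite SB; apply: eq_specmx => i; rewrite bn.
    by rewrite /rform Sform mxE eqxx mulr1n.
  exists B, b; split; [exact: B1|exact: b0|exact: bE| |] => x; rewrite bform.
    by rewrite mulr_natl mulr2n lerD.
  exact: WUV.
(* Domination of |A| and |A^*| by the limit is the case [n = 1] of the inequalities for powers. *)
have form1 k (Z : 'M[R[i]]_(k, d)) (a : 'I_k -> R) x :
    wform Z a x = wform Z (fun i => a i ^+ 1) x.
  by apply: eq_bigr => i _; rewrite expr1.
split=> [|x|x].
(* The basis [W] need not be the one used by [mxfun], so the limit is diagonalized anew. *)
- rewrite maxmodE; apply: psd_spectral_of => [|x].
    by rewrite specmx_trC; apply: eq_specmx => i; rewrite conjC_real.
  by rewrite specmx_form mxE eqxx mulr1n ler0c wform_ge0.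
- by rewrite maxmodE PE !rform_specmx form1 [leRHS]form1.
- by rewrite maxmodE QE !rform_specmx form1 [leRHS]form1.
Qed.

(** * Contractions and the factorization of [A] *)

Lemma l2norm_sqr (R : realType) d (v : 'cV[R[i]]_d) :
  l2norm v = Num.sqrt (nsq (v ^t*)).
Proof.
rewrite /l2norm /nsq; congr Num.sqrt; apply: eq_bigr => j _.
rewrite !mxE sqn_conj; case: (v j 0) => a b /=.
by rewrite sqr_sqrtr ?addr_ge0 ?sqr_ge0.
Qed.

Lemma contraction_nsq (R : realType) d (K : 'M[R[i]]_d) :
  (forall v : 'cV_d, nsq ((K *m v) ^t*) <= nsq (v ^t*)) -> contraction_mx K.
Proof.
move=> Kle; apply: ge_sup.
  (* The bound on [sup] requires a nonempty set; the zero vector provides a point. *)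
  exists (l2norm (K *m (0 : 'cV_d))), 0 => //=.
  rewrite l2norm_sqr trmx0 map_mx0 /nsq big1 ?sqrtr0 // => j _.
  by rewrite mxE sqn0.
move=> _ [v /= v1 <-]; apply: le_trans v1.
by rewrite !l2norm_sqr ler_wsqrtr.
Qed.

Theorem lemma3p3 (R : realType) (d : nat) (hd : (1 <= d)%N) (A : 'M[R[i]]_d) :
  exists K : 'M[R[i]]_d,
    contraction_mx K /\ A = mxroot 2 (maxmod A) *m K *m mxroot 2 (maxmod A).
Proof.
have [[U [s Us]] PM QM] := maxmod_dominates A.
have [g [g0 -> g2]] := mxroot_spectral 2 Us.
have [U1 s0 ME _] := Us.
have {}ME : maxmod A = specmx U (fun i => (g i ^+ 2)%:C).
  by rewrite ME; apply: eq_specmx => i; rewrite g2.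
set G := specmx U (fun i => (g i)%:C).
pose H := specmx U (fun i => ((g i)^-1)%:C).
have specmx_herm (a : 'I_d -> R) :
    (specmx U (fun i => (a i)%:C)) ^t* = specmx U (fun i => (a i)%:C).
  by rewrite specmx_trC; apply: eq_specmx => i; rewrite conjC_real.
have GH : G *m H = specmx U (fun i => (g i * (g i)^-1)%:C).
  by rewrite (specmxM _ _ U1); apply: eq_specmx => i; rewrite rmorphM.
have HG : H *m G = G *m H.
  by rewrite GH (specmxM _ _ U1); apply: eq_specmx => i; rewrite mulrC rmorphM.
have Gh : G ^t* = G by exact: specmx_herm.
have Hh : H ^t* = H by exact: specmx_herm.
have GHM : G *m H *m maxmod A = maxmod A.
  rewrite GH ME (specmxM _ _ U1); apply: eq_specmx => i.
  rewrite -rmorphM expr2; have [->|gi0] := eqVneq (g i) 0.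
    by rewrite !mulr0.
  by rewrite (mulfV gi0) mul1r.
have HMHE : H *m maxmod A *m H =
    specmx U (fun i => ((g i)^-1 * g i ^+ 2 * (g i)^-1)%:C).
  by rewrite ME !(specmxM _ _ U1); apply: eq_specmx => i; rewrite !rmorphM.
(* The eigenvalues of [H *m maxmod A *m H] are 1, or 0 where [g i = 0]. *)
have HMH x : rform (maxmod A) (x *m H) <= nsq x.
  have -> : rform (maxmod A) (x *m H) =
      wform U (fun i => (g i)^-1 * g i ^+ 2 * (g i)^-1) x.
    rewrite -rform_specmx -HMHE; move: (maxmod A) (H) Hh => M H' H'h.
    by rewrite /rform trmxCM H'h !mulmxA.
  rewrite -(nsq_isom x (unitary_trC U1)); apply: ler_sum => i _.
  apply: ler_piMl; first exact: sqn_ge0.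
  have [->|gi0] := eqVneq (g i) 0.
    by rewrite invr0 mulr0.
  by rewrite expr2 (mulKf gi0) (mulfV gi0).
clearbody G H; clear HMHE GH ME.
(* [Z] is the projection onto the kernel of [maxmod A]. The forms of |A| and |A^*|, being dominated,
   are at most 0 on its rows, so [Z] annihilates [A] and [A ^t*]. *)
pose Z := 1%:M - G *m H.
have Zh : Z ^t* = Z by rewrite trmxCB trmxC1 trmxCM Gh Hh HG.
have ZM : Z *m maxmod A = 0 by rewrite mulmxBl mul1mx GHM subrr.
have Zform i : rform (maxmod A) (row i Z) = 0.
  by rewrite /rform -row_mul ZM row0 mul0mx mxE.
have ZA : Z *m A = 0.
  apply/row_matrixP => i; rewrite row_mul row0 -[in LHS](trmxCK A).
  by apply: absmx_ker; rewrite -(Zform i).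
have ZAt : Z *m A ^t* = 0.
  apply/row_matrixP => i; rewrite row_mul row0.
  by apply: absmx_ker; rewrite -(Zform i).
have AZ : A *m Z = 0.
  by rewrite -[A]trmxCK -Zh -trmxCM ZAt trmx0 map_mx0.
have GHA : G *m H *m A = A.
  by apply/eqP; rewrite eq_sym -subr_eq0 -{1}(mul1mx A) -mulmxBl; apply/eqP.
have AGH : A *m (G *m H) = A.
  by apply/eqP; rewrite eq_sym -subr_eq0 -{1}(mulmx1 A) -mulmxBr; apply/eqP.
exists (H *m A *m H); split; last first.
  by rewrite !mulmxA GHA -!mulmxA HG AGH.
apply: contraction_nsq => v; set u := (H *m A *m H *m v) ^t*.
have := absmx_mixed A (u *m H) (v ^t* *m H).
have -> : complex.Re ((u *m H *m A *m (v ^t* *m H) ^t*) 0 0) = nsq u.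
  by rewrite nsq_Re trmxCM trmxCK Hh {3}/u trmxCK !mulmxA.
have := le_trans (PM _) (HMH (v ^t*)); have := le_trans (QM _) (HMH u).
by move: (rform _ _) (rform _ _) (nsq _) (nsq _) => a b e f; lra.
Qed.
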